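(* Let $C$ be a subcoalgebra of $H$. Then $C$ is invariant under the adjoint action of $H$ (i.e. $\sum h_1\,c\,S(h_2)\in C$ for all $h\in H$, $c\in C$) if and only if its character $d_C=\sum_{d\in\mathrm{Irr}(C)}\epsilon(d)\,d$ is a central element of $H$.
   Context: Let $k$ be an algebraically closed field of characteristic $0$ and $H$ a finite-dimensional semisimple Hopf algebra over $k$ (comultiplication $\Delta(h)=\sum h_1\otimes h_2$, counit $\epsilon$, antipode $S$); $H$ is also cosemisimple. Characters of $H^*$-modules (equivalently of $H$-comodules) are elements of $H$; $\mathrm{Irr}(H^* )\subset H$ is the set of irreducible ones. Each $d\in\mathrm{Irr}(H^* )$ lies in a unique simple subcoalgebra $C_d$ of $H$ (the coefficient coalgebra of the corresponding simple comodule), $H=\bigoplus_{d\in\mathrm{Irr}(H^* )}C_d$, and every subcoalgebra $C$ of $H$ is $\bigoplus_{d\in\mathrm{Irr}(C)}C_d$ where $\mathrm{Irr}(C)$ is the set of $d\in\mathrm{Irr}(H^* )$ with $d\in C$. Thus $d_C$ is the character of $C$ as a left (equivalently right) $H$-comodule. *)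

(* Defs.v *)
(* Finite-dimensional Hopf algebras encoded in coordinates
   with respect to the canonical basis [hb H := vbasis {:H}] of H.
   An element t of H (x) H is a matrix t : 'M_(n,n), n = \dim {:H},
   standing for  \sum_(i,j) t i j  hb_i (x) hb_j. *)
From HB Require Import structures.
From mathcomp Require Import all_boot all_order all_algebra all_field.
Set Implicit Arguments. Unset Strict Implicit. Unset Printing Implicit Defensive.
Import Order.TTheory GRing.Theory Num.Theory.
Local Open Scope ring_scope.

Section Hopf.
Variables (k : fieldType) (H : falgType k).

Notation n := (\dim (fullv : {vspace H})).

Definition hb : n.-tuple H := vbasis fullv.

Definition tens := 'M[k]_(n, n).

(* "Sweedler sum":  tsum t F = \sum_(i,j) t_ij F(hb_i, hb_j), i.e. the image of
   t under the linear map induced by the bilinear map F. *)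
Definition tsum (V : lmodType k) (t : tens) (F : H -> H -> V) : V :=
  \sum_(i < n) \sum_(j < n) t i j *: F (tnth hb i) (tnth hb j).

(* right (resp. left) tensor components with respect to the basis:
   t = \sum_i hb_i (x) rcomp t i = \sum_j lcomp t j (x) hb_j *)
Definition rcomp (t : tens) (i : 'I_n) : H := \sum_(j < n) t i j *: tnth hb j.
Definition lcomp (t : tens) (j : 'I_n) : H := \sum_(i < n) t i j *: tnth hb i.

Definition is_hopf (D : H -> tens) (e : H -> k) (S : H -> H) : Prop :=
  [/\
      (forall (a : k) (x y : H), D (a *: x + y) = a *: D x + D y),
      (forall (a : k) (x y : H), e (a *: x + y) = a * e x + e y),
      (forall (a : k) (x y : H), S (a *: x + y) = a *: S x + S y) &
      [/\ (* coassociativity: (D (x) id) D = (id (x) D) D, in coordinates *)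
      (forall (h : H) (p q r : 'I_n),
         \sum_(i < n) D h i r * D (tnth hb i) p q
         = \sum_(j < n) D h p j * D (tnth hb j) q r),
      (forall h : H, tsum (D h) (fun x y => e x *: y) = h
                  /\ tsum (D h) (fun x y => e y *: x) = h) &
      [/\
      (forall (x y : H) (p q : 'I_n),
         D (x * y) p q =
         \sum_(i < n) \sum_(j < n) \sum_(i' < n) \sum_(j' < n)
            D x i j * D y i' j' * coord hb p (tnth hb i * tnth hb i')
                                 * coord hb q (tnth hb j * tnth hb j')),
      (forall p q : 'I_n, D 1 p q = coord hb p 1 * coord hb q 1) &
      [/\
      (forall x y : H, e (x * y) = e x * e y),
      e 1 = 1 &
      (forall h : H, tsum (D h) (fun x y => S x * y) = e h *: 1
                  /\ tsum (D h) (fun x y => x * S y) = e h *: 1)]]]].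

Definition lideal (I : {vspace H}) : Prop :=
  forall a x : H, x \in I -> a * x \in I.
Definition semisimple : Prop :=
  forall I, lideal I -> exists J, [/\ lideal J, (I + J)%VS = fullv & (I :&: J)%VS = 0%VS].

(* left coideals = left subcomodules of H (D(I) \subset H (x) I);
   cosemisimplicity: every left subcomodule of H has a complementary one *)
Definition lcoideal (D : H -> tens) (I : {vspace H}) : Prop :=
  forall (x : H) (i : 'I_n), x \in I -> rcomp (D x) i \in I.
Definition cosemisimple (D : H -> tens) : Prop :=
  forall I, lcoideal D I ->
    exists J, [/\ lcoideal D J, (I + J)%VS = fullv & (I :&: J)%VS = 0%VS].

(* subcoalgebra: D(C) \subset C (x) C  (= (C (x) H) \cap (H (x) C)) *)
Definition subcoalgebra (D : H -> tens) (C : {vspace H}) : Prop :=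
  forall (x : H) (i : 'I_n), x \in C -> rcomp (D x) i \in C /\ lcomp (D x) i \in C.

Definition ad_invariant (D : H -> tens) (S : H -> H) (C : {vspace H}) : Prop :=
  forall h c : H, c \in C -> tsum (D h) (fun x y => x * c * S y) \in C.

(* character of the left H-comodule C (coaction D restricted to C):
   d_C = \sum_l (id (x) c_l^* ) D(c_l), (c_l) = vbasis C, (c_l^* ) dual basis *)
Definition comod_char (D : H -> tens) (C : {vspace H}) : H :=
  \sum_(l < \dim C) \sum_(i < n)
     coord (vbasis C) l (rcomp (D (tnth (vbasis C) l)) i) *: tnth hb i.

Definition central (z : H) : Prop := forall h : H, z * h = h * z.

End Hopf.

(* Main.v *)
(** Let [L] and [l] be integrals of [H] and of its dual [H*], and use Sweedler's indices.
    Semisimplicity and cosemisimplicity provide two-sided integrals with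
    [e L = 1] and [l 1 = 1]; the Frobenius systems they define give [S^4 = id], and a
    trace argument (Larson-Radford) then gives [S^2 = id] in characteristic 0, so that [L]
    is cocommutative.  Let [g] be the central idempotent of [H*] with
    [h1 g(h2) = g(h1) h2] projecting [H] onto [C].  Computing traces with [L] and [l], the
    character of [C] is a nonzero multiple of [z = L1 g(L2)].  Since
    [S(h1) z h2 = L1 g(h1 L2 S(h2))] and [L] is nondegenerate, [z] is central iff [g] is
    invariant under the adjoint action, in which case the projection onto [C] commutes
    with the adjoint action and [C] is stable.  Conversely, if [C] is stable, averaging
    over [L] makes the projection equivariant while keeping it colinear, and a
    colinear projection onto a subcoalgebra is unique. *)
Require Import Defs.
From HB Require Import structures.
From mathcomp Require Import all_boot all_order all_algebra all_field.
From mathcomp Require Import ring zify.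
Import GRing.Theory.
Local Open Scope ring_scope.

Set Implicit Arguments.
Unset Strict Implicit.
Unset Printing Implicit Defensive.

(** Linearity is a predicate on bare functions, since [D], [e], [S] and the integrands of Sweedler
    sums come without a bundled structure. A functional gets the codomain [k^o], the field as a
    module over itself. *)
Definition lin (k : fieldType) (V W : lmodType k) (f : V -> W) : Prop :=
  forall (a : k) (x y : V), f (a *: x + y) = a *: f x + f y.

(** * Closure properties of linear maps *)

Section Linear.
Variable k : fieldType.
Implicit Types V W X : lmodType k.

Lemma lin0 V W (f : V -> W) : lin f -> f 0 = 0.
Proof.
move=> lf; have := lf (-1) 0 0.
by rewrite scaler0 addr0 scaleN1r addNr.
Qed.

Lemma linD V W (f : V -> W) : lin f -> forall x y, f (x + y) = f x + f y.
Proof. by move=> lf x y; have := lf 1 x y; rewrite !scale1r. Qed.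

Lemma linZ V W (f : V -> W) : lin f -> forall a x, f (a *: x) = a *: f x.
Proof. by move=> lf a x; have := lf a x 0; rewrite !addr0 (lin0 lf) addr0. Qed.

Lemma linB V W (f : V -> W) : lin f -> forall x y, f (x - y) = f x - f y.
Proof. by move=> lf x y; rewrite (linD lf) -[- y]scaleN1r (linZ lf) scaleN1r. Qed.

Lemma lin_sum V W (f : V -> W) : lin f ->
  forall (I : Type) (r : seq I) (P : pred I) (F : I -> V),
  f (\sum_(i <- r | P i) F i) = \sum_(i <- r | P i) f (F i).
Proof.
move=> lf I r P F; apply: (big_morph f); first exact: linD.
exact: lin0.
Qed.

Lemma lin_id V : lin (fun x : V => x).
Proof. by []. Qed.

Lemma lin_comp V W X (f : W -> X) (g : V -> W) :
  lin f -> lin g -> lin (fun x => f (g x)).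
Proof. by move=> lf lg a x y; rewrite lg lf. Qed.

Lemma lin_scaler V W (a : k) (f : V -> W) : lin f -> lin (fun x => a *: f x).
Proof. by move=> lf b x y; rewrite lf scalerDr !scalerA mulrC. Qed.

Lemma lin_scalel V W (f : V -> k^o) (w : W) : lin f -> lin (fun x => f x *: w).
Proof. by move=> lf b x y; rewrite lf scalerDl scalerA. Qed.

Lemma lin_add V W (f g : V -> W) : lin f -> lin g -> lin (fun x => f x + g x).
Proof. by move=> lf lg b x y; rewrite lf lg scalerDr addrACA. Qed.

Lemma lin_opp V W (f : V -> W) : lin f -> lin (fun x => - f x).
Proof. by move=> lf b x y; rewrite lf opprD scalerN. Qed.

Lemma lin_bigsum V W (I : Type) (r : seq I) (P : pred I) (F : I -> V -> W) :
  (forall i, lin (F i)) -> lin (fun x => \sum_(i <- r | P i) F i x).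
Proof.
move=> lF a x y; rewrite scaler_sumr -big_split; apply: eq_bigr => i _.
exact: lF.
Qed.

Lemma lin_linear V W (f : {linear V -> W}) : lin f.
Proof. by move=> a x y; rewrite linearP. Qed.

Lemma lin_mull (A : algType k) V (a : A) (f : V -> A) :
  lin f -> lin (fun x => a * f x).
Proof. by move=> lf b x y; rewrite lf mulrDr scalerAr. Qed.

Lemma lin_mulr (A : algType k) V (a : A) (f : V -> A) :
  lin f -> lin (fun x => f x * a).
Proof. by move=> lf b x y; rewrite lf mulrDl scalerAl. Qed.

Lemma lin_kernel (V : vectType k) (W : vectType k) (f : V -> W) : lin f ->
  exists K : {vspace V}, forall x, (x \in K) = (f x == 0).
Proof.
move=> lf; pose g : {linear V -> W} := HB.pack f (GRing.isLinear.Build k V W *:%R f lf).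
by exists (lker (linfun g)) => x; rewrite memv_ker lfunE.
Qed.

End Linear.

(** * Tensors of [H (x) H] in coordinates *)

Section Tensor.
Variables (k : fieldType) (H : falgType k).
Implicit Types (V W : lmodType k) (t u : tens H).
Local Notation n := (\dim (fullv : {vspace H})).
Local Notation b_ i := (tnth (hb H) i).

Lemma hb_coord (x : H) : x = \sum_(i < n) coord (hb H) i x *: b_ i.
Proof.
rewrite {1}(coord_vbasis (memvf x)); apply: eq_bigr => i _.
by rewrite /hb (tnth_nth 0).
Qed.

Lemma coord_hb (i j : 'I_n) : coord (hb H) i (b_ j) = (i == j)%:R.
Proof.
rewrite (tnth_nth 0) coord_free; first by rewrite -val_eqE eq_sym.
exact: basis_free (vbasisP _).
Qed.

Lemma lin_coord (m : nat) (X : m.-tuple H) i : lin (coord X i : H -> k^o).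
Proof. exact: lin_linear. Qed.

Definition bilin V (F : H -> H -> V) : Prop :=
  (forall y, lin (F^~ y)) /\ (forall x, lin (F x)).

Lemma eq_tsum V t (F G : H -> H -> V) :
  (forall x y, F x y = G x y) -> tsum t F = tsum t G.
Proof.
by move=> eFG; apply: eq_bigr => i _; apply: eq_bigr => j _; rewrite eFG.
Qed.

Lemma lin_tsuml V (F : H -> H -> V) : lin (fun t => tsum t F).
Proof.
apply: lin_bigsum => i; apply: lin_bigsum => j; apply: lin_scalel.
by move=> a t u; rewrite !mxE.
Qed.

Lemma lin_tsumr V W t (F : W -> H -> H -> V) :
  (forall x y, lin (fun w => F w x y)) -> lin (fun w => tsum t (F w)).
Proof.
by move=> lF; apply: lin_bigsum => i; apply: lin_bigsum => j; apply: lin_scaler.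
Qed.

Lemma tsum_lin V W (f : V -> W) t (F : H -> H -> V) :
  lin f -> f (tsum t F) = tsum t (fun x y => f (F x y)).
Proof.
move=> lf; rewrite /tsum (lin_sum lf); apply: eq_bigr => i _.
by rewrite (lin_sum lf); apply: eq_bigr => j _; rewrite (linZ lf).
Qed.

Lemma tsumZ V t a (F : H -> H -> V) : a *: tsum t F = tsum t (fun x y => a *: F x y).
Proof. by apply: (tsum_lin (f := *:%R a)); apply: lin_scaler. Qed.

Lemma tsumB V t (F G : H -> H -> V) :
  tsum t (fun x y => F x y - G x y) = tsum t F - tsum t G.
Proof.
rewrite /tsum -sumrB; apply: eq_bigr => i _; rewrite -sumrB; apply: eq_bigr => j _.
exact: scalerBr.
Qed.

Lemma tsumMl t x (F : H -> H -> H) : x * tsum t F = tsum t (fun a b => x * F a b).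
Proof. by apply: (tsum_lin (f := *%R x)); apply: lin_mull. Qed.

Lemma tsumMr t x (F : H -> H -> H) : tsum t F * x = tsum t (fun a b => F a b * x).
Proof. by apply: (tsum_lin (f := *%R^~ x)); apply: lin_mulr. Qed.

Lemma tsum_sum V u m (G : 'I_m -> H -> H -> V) :
  \sum_(i < m) tsum u (G i) = tsum u (fun c d => \sum_(i < m) G i c d).
Proof.
rewrite exchange_big; apply: eq_bigr => p _; rewrite exchange_big; apply: eq_bigr => q _.
by rewrite scaler_sumr.
Qed.

Lemma tsum_exchange V t u (F : H -> H -> H -> H -> V) :
  tsum t (fun a b => tsum u (F a b)) = tsum u (fun c d => tsum t (fun a b => F a b c d)).
Proof.
rewrite -tsum_sum; apply: eq_bigr => i _; rewrite -tsum_sum; apply: eq_bigr => j _.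
by rewrite tsumZ.
Qed.

Lemma tsum_rcomp V t (F : H -> H -> V) : bilin F ->
  tsum t F = \sum_(i < n) F (b_ i) (rcomp t i).
Proof.
case=> _ lF; apply: eq_bigr => i _.
by rewrite (lin_sum (lF _)); apply: eq_bigr => j _; rewrite (linZ (lF _)).
Qed.

Lemma tsum_lcomp V t (F : H -> H -> V) : bilin F ->
  tsum t F = \sum_(j < n) F (lcomp t j) (b_ j).
Proof.
case=> lF _; rewrite /tsum exchange_big; apply: eq_bigr => j _.
by rewrite (lin_sum (lF _)); apply: eq_bigr => i _; rewrite (linZ (lF _)).
Qed.

(** The elementary tensor [x (x) y]. Together, [tsum_pure] and [tsumE] express the universal
    property of the tensor product. *)
Definition pure (x y : H) : tens H :=
  \matrix_(p, q) (coord (hb H) p x * coord (hb H) q y).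

Lemma bilin_pure : bilin pure.
Proof.
split=> [y|x] a u v; apply/matrixP => p q; rewrite !mxE linearP /=.
  by rewrite mulrDl mulrA.
by rewrite mulrDr mulrCA.
Qed.

Lemma tsum_pure V (F : H -> H -> V) x y : bilin F -> tsum (pure x y) F = F x y.
Proof.
case=> l1 l2; rewrite [in RHS](hb_coord x) (lin_sum (l1 _)); apply: eq_bigr => i _.
rewrite (linZ (l1 _)) [in RHS](hb_coord y) (lin_sum (l2 _)) scaler_sumr.
apply: eq_bigr => j _.
by rewrite mxE (linZ (l2 _)) scalerA.
Qed.

Lemma tsumE t : tsum t pure = t.
Proof.
apply/matrixP => p q; rewrite /tsum summxE (bigD1 p) //= summxE (bigD1 q) //=.
rewrite !mxE !coord_hb !eqxx !mulr1 !big1 ?addr0 // => [i ip|j jq].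
  rewrite summxE big1 // => j _.
  by rewrite !mxE !coord_hb [p == i]eq_sym (negPf ip) mul0r mulr0.
by rewrite !mxE !coord_hb [q == j]eq_sym (negPf jq) !mulr0.
Qed.

End Tensor.

(** * Traces of endomorphisms of [H] *)

Section Trace.
Variables (k : fieldType) (H : falgType k).
Local Notation n := (\dim (fullv : {vspace H})).
Local Notation b_ i := (tnth (hb H) i).
Implicit Types T P J : H -> H.

Definition htr T : k := \sum_(i < n) coord (hb H) i (T (b_ i)).

Definition hmx T : 'M[k]_n := \matrix_(i, j) coord (hb H) j (T (b_ i)).

Lemma htrE T : htr T = \tr (hmx T).
Proof. by apply: eq_bigr => i _; rewrite mxE. Qed.

Lemma eq_htr T P : (forall x, T x = P x) -> htr T = htr P.
Proof. by move=> eTP; apply: eq_bigr => i _; rewrite eTP. Qed.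

Lemma hmx_comp T P : lin T -> hmx (fun x => T (P x)) = hmx P *m hmx T.
Proof.
move=> lT; apply/matrixP => i j; rewrite !mxE {1}(hb_coord (P (b_ i))) (lin_sum lT).
rewrite linear_sum; apply: eq_bigr => p _.
by rewrite !mxE (linZ lT) linearZ.
Qed.

Lemma htr_comm T P : lin T -> lin P -> htr (fun x => T (P x)) = htr (fun x => P (T x)).
Proof.
by move=> lT lP; rewrite [LHS]htrE [RHS]htrE (hmx_comp P lT) (hmx_comp T lP) mxtrace_mulC.
Qed.

Lemma htrD T P : htr (fun x => T x + P x) = htr T + htr P.
Proof. by rewrite -big_split; apply: eq_bigr => i _; rewrite linearD. Qed.

Lemma htrZ a T : htr (fun x => a *: T x) = a * htr T.
Proof. by rewrite mulr_sumr; apply: eq_bigr => i _; rewrite linearZ. Qed.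

Lemma htr_id : htr id = n%:R.
Proof.
rewrite /htr; under eq_bigr => i _ do rewrite coord_hb eqxx.
by rewrite sumr_const card_ord.
Qed.

(** In a rank factorisation [A = U W] of an idempotent, cancelling the full-rank outer factors of
    [A A = A] leaves [W U = 1], and [U W] and [W U] have the same trace. *)
Lemma mxtrace_idem m (A : 'M[k]_m) : A *m A = A -> \tr A = (\rank A)%:R.
Proof.
move=> AA; rewrite -{1}(mulmx_base A) mxtrace_mulC.
have /row_freeP := row_base_free A; have /row_fullP := col_base_full A.
have : col_base A *m row_base A *m (col_base A *m row_base A) = col_base A *m row_base A.
  by rewrite mulmx_base.
move: (\rank A) (col_base A) (row_base A) => r U W UW [C CU] [R WR].
suff -> : W *m U = 1%:M by rewrite mxtrace1.
transitivity (C *m (U *m W *m (U *m W)) *m R); last first.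
  by rewrite UW mulmxA CU mul1mx.
by rewrite !mulmxA CU mul1mx -mulmxA WR mulmx1.
Qed.

(** The rank is returned as a natural number, so that its vanishing can be turned back into an
    identity of maps. *)
Lemma htr_idem P : lin P -> (forall x, P (P x) = P x) ->
  exists r : nat, htr P = r%:R /\ (r = 0%N -> forall x, P x = 0).
Proof.
move=> lP PP; exists (\rank (hmx P)); rewrite htrE; split.
  apply: mxtrace_idem; rewrite -(hmx_comp P lP).
  by apply/matrixP => i j; rewrite !mxE PP.
move/eqP; rewrite mxrank_eq0 => /eqP P0 x.
rewrite (hb_coord x) (lin_sum lP) big1 // => i _; rewrite (linZ lP).
rewrite (hb_coord (P _)) big1 ?scaler0 // => j _.
by move/matrixP: P0 => /(_ i j); rewrite !mxE => ->; rewrite scale0r.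
Qed.

(** The numbers [r] and [s] are the dimensions of the eigenspaces of [J] for 1 and -1 inside the
    image of [P], which [J] preserves because the two maps commute. *)
Lemma htr_involution J P : (2%:R : k) != 0 -> lin J -> lin P ->
    (forall x, J (J x) = x) -> (forall x, P (P x) = P x) -> (forall x, P (J x) = J (P x)) ->
  exists r s : nat, [/\ htr P = r%:R + s%:R, htr (fun x => J (P x)) = r%:R - s%:R,
    (r = 0%N -> forall x, J (P x) = - P x) & (s = 0%N -> forall x, J (P x) = P x)].
Proof.
move=> two lJ lP JJ PP PJ.
have two2 (y : H) : 2^-1 *: (y + y) = y.
  by rewrite -mulr2n -scaler_nat scalerA mulVf // scale1r.
have hyp (sg : k) : sg * sg = 1 -> exists r : nat,
    2^-1 * (htr P + sg * htr (fun x => J (P x))) = r%:R /\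
    (r = 0%N -> forall x, J (P x) = - sg *: P x).
  (* [Q] projects onto the [sg]-eigenspace of [J] inside the image of [P]. *)
  move=> sg2; pose Q x := 2^-1 *: (P x + sg *: J (P x)).
  have lJP : lin (fun x => J (P x)) := lin_comp lJ lP.
  have lQ : lin Q by apply/lin_scaler/lin_add/lin_scaler.
  have QQ x : Q (Q x) = Q x.
    have PQ : P (Q x) = Q x by rewrite /Q (linZ lP) (linD lP) (linZ lP) PJ !PP.
    have JQ : sg *: J (Q x) = Q x.
      rewrite /Q (linZ lJ) (linD lJ) (linZ lJ) JJ scalerA mulrC -scalerA scalerDr scalerA.
      by rewrite sg2 scale1r addrC.
    by rewrite {1}/Q PQ JQ two2.
  have [r [tQ r0]] := htr_idem lQ QQ.
  exists r; rewrite -tQ htrZ htrD htrZ; split=> // /r0 Q0 x.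
  have /eqP := Q0 x; rewrite /Q scaler_eq0 invr_eq0 (negPf two) /= addr_eq0 => /eqP PE.
  by rewrite [X in _ *: X]PE scaleNr scalerN opprK scalerA sg2 scale1r.
have [|r [tr r0]] := hyp 1; first exact: mulr1.
have [|s [ts s0]] := hyp (-1); first by rewrite mulrNN mulr1.
exists r, s; split=> [||/r0 H0 x|/s0 H0 x].
- by rewrite -tr -ts; field.
- by rewrite -tr -ts; field.
- by rewrite H0 scaleN1r.
- by rewrite H0 opprK scale1r.
Qed.

End Trace.

(** * Sweedler calculus in a Hopf algebra *)

Section Hopf.
Variables (k : fieldType) (H : falgType k).
Variables (D : H -> tens H) (e : H -> k) (S : H -> H).
Hypothesis hopf : is_hopf D e S.
Local Notation n := (\dim (fullv : {vspace H})).
Local Notation b_ i := (tnth (hb H) i).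
Implicit Types (V W : lmodType k) (h x y z : H).

Local Notation "\sw_ ( x , y <- h ) E" := (tsum (D h) (fun x y => E))
  (at level 36, E at level 36, h at level 50, x name, y name,
   format "'[' \sw_ ( x ,  y  <-  h ) '/  '  E ']'").

Lemma lin_D : lin D.
Proof. by case: hopf. Qed.

Lemma lin_e : lin (e : H -> k^o).
Proof. by case: hopf. Qed.

Lemma lin_S : lin S.
Proof. by case: hopf. Qed.

(** Proves linearity and bilinearity of integrands by recursion on their syntax. In the patterns,
    [@?f w'] captures the argument that depends on the variable, while [?c] must be independent of
    it. *)
Ltac slin := cbv beta; first
 [ exact: lin_id
 | exact: lin_S
 | exact: lin_e
 | exact: lin_D
 | exact: lin_coord
 | assumption
 | match goal with
   | |- forall _, _ => intro; slin
   | |- bilin _ => split; slin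
   | |- lin (fun w' => @GRing.mul _ (@?f w') ?c) => apply: (lin_mulr c (f := f)); slin
   | |- lin (fun w' => @GRing.mul _ ?c (@?f w')) => apply: (lin_mull c (f := f)); slin
   | |- lin (fun w' => @GRing.scale _ _ (@?f w') ?c) => apply: (lin_scalel c (f := f)); slin
   | |- lin (fun w' => @GRing.scale _ _ ?c (@?f w')) => apply: (lin_scaler c (f := f)); slin
   | |- lin (fun w' => S (@?f w')) => apply: (lin_comp (g := f) lin_S); slin
   | |- lin (fun w' => e (@?f w')) => apply: (lin_comp (g := f) lin_e); slin
   | |- lin (fun w' => D (@?f w')) => apply: (lin_comp (g := f) lin_D); slin
   | |- lin (fun w' => tsum (@?f w') ?F) =>
        apply: (lin_comp (g := f) (lin_tsuml F)); slin
   | |- lin (fun w' => tsum ?t (@?F w')) => apply: (lin_tsumr (F := F) t); slin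
   | lg : lin ?g |- lin (fun w' => ?g (@?f w')) => apply: (lin_comp (g := f) lg); slin
   | bF : bilin ?F |- lin (fun w' => ?F (@?f w') ?c) =>
        apply: (lin_comp (g := f) (proj1 bF c)); slin
   | bF : bilin ?F |- lin (fun w' => ?F ?c (@?f w')) =>
        apply: (lin_comp (g := f) (proj2 bF c)); slin
   | |- lin (fun w' => coord ?X ?i (@?f w')) => apply: (lin_comp (g := f) (lin_coord X i)); slin
   | bF : bilin ?F |- lin (?F ?c) => exact: (proj2 bF c)
   | |- lin (fun w' => @GRing.add _ (@?f w') (@?g w')) => apply: (lin_add (f := f) (g := g)); slin
   | |- lin (fun w' => @GRing.opp _ (@?f w')) => apply: (lin_opp (f := f)); slin
   end ].

(** Since [tsum] evaluates [G] on basis vectors only, both sides are sums of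
    [G (b_ p) (b_ q) (b_ r)] weighted by the coefficients of the two iterated coproducts, which the
    coordinate axiom equates. *)
Lemma coassoc V (G : H -> H -> H -> V) h :
  \sw_(x, y <- h) \sw_(a, b <- x) G a b y = \sw_(x, y <- h) \sw_(a, b <- y) G x a b.
Proof.
have [_ _ _ [coA _ _]] := hopf.
transitivity (\sum_(p < n) \sum_(q < n) \sum_(r < n)
    (\sum_(i < n) D h i r * D (b_ i) p q) *: G (b_ p) (b_ q) (b_ r)).
  rewrite /tsum.
  under eq_bigr => i _ do under eq_bigr => r _ do
    (rewrite scaler_sumr; under eq_bigr => p _ do rewrite scaler_sumr).
  under eq_bigr => i _ do (rewrite exchange_big; under eq_bigr => p _ do rewrite exchange_big).
  rewrite exchange_big; apply: eq_bigr => p _.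
  rewrite exchange_big; apply: eq_bigr => q _.
  rewrite exchange_big; apply: eq_bigr => r _ /=.
  by rewrite scaler_suml; apply: eq_bigr => i _; rewrite scalerA.
rewrite /tsum; apply: eq_bigr => p _.
under [RHS]eq_bigr => j _ do
  (rewrite scaler_sumr; under eq_bigr => q _ do rewrite scaler_sumr).
rewrite [RHS]exchange_big; apply: eq_bigr => q _.
rewrite [RHS]exchange_big; apply: eq_bigr => r _ /=.
by rewrite coA scaler_suml; apply: eq_bigr => j _; rewrite scalerA.
Qed.

Lemma counitl V (f : H -> V) h : lin f -> \sw_(x, y <- h) (e x *: f y) = f h.
Proof.
move=> lf; have [_ _ _ [_ cu _]] := hopf.
rewrite -[in RHS](cu h).1 (tsum_lin _ _ lf); apply: eq_tsum => x y.
by rewrite (linZ lf).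
Qed.

Lemma counitr V (f : H -> V) h : lin f -> \sw_(x, y <- h) (e y *: f x) = f h.
Proof.
move=> lf; have [_ _ _ [_ cu _]] := hopf.
rewrite -[in RHS](cu h).2 (tsum_lin _ _ lf); apply: eq_tsum => x y.
by rewrite (linZ lf).
Qed.

Lemma comul_mul V (F : H -> H -> V) x y : bilin F ->
  tsum (D (x * y)) F = \sw_(a, b <- x) \sw_(c, d <- y) F (a * c) (b * d).
Proof.
move=> bF; have [_ _ _ [_ _ [DM _ _]]] := hopf.
have -> : D (x * y) = \sw_(a, b <- x) \sw_(c, d <- y) pure (a * c) (b * d).
  apply/matrixP => p q; rewrite DM /tsum summxE; apply: eq_bigr => i _.
  rewrite summxE; apply: eq_bigr => j _.
  rewrite mxE summxE mulr_sumr; apply: eq_bigr => i' _.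
  rewrite summxE mulr_sumr; apply: eq_bigr => j' _.
  by rewrite !mxE !mulrA.
rewrite (tsum_lin _ _ (lin_tsuml F)); apply: eq_tsum => a b.
rewrite (tsum_lin _ _ (lin_tsuml F)); apply: eq_tsum => c d.
exact: tsum_pure.
Qed.

Lemma comul_unit V (F : H -> H -> V) : bilin F -> tsum (D 1) F = F 1 1.
Proof.
move=> bF; have [_ _ _ [_ _ [_ D1 _]]] := hopf.
have -> : D 1 = pure 1 1 by apply/matrixP => p q; rewrite D1 mxE.
exact: tsum_pure.
Qed.

Lemma counitM x y : e (x * y) = e x * e y.
Proof. by have [_ _ _ [_ _ [_ _ [-> _ _]]]] := hopf. Qed.

Lemma counit1 : e 1 = 1.
Proof. by have [_ _ _ [_ _ [_ _ [_ -> _]]]] := hopf. Qed.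

Lemma antipodel V (f : H -> V) h : lin f -> \sw_(x, y <- h) f (S x * y) = e h *: f 1.
Proof.
move=> lf; have [_ _ _ [_ _ [_ _ [_ _ /(_ h)[Sl _]]]]] := hopf.
by rewrite -(linZ lf) -Sl (tsum_lin _ _ lf).
Qed.

Lemma antipoder V (f : H -> V) h : lin f -> \sw_(x, y <- h) f (x * S y) = e h *: f 1.
Proof.
move=> lf; have [_ _ _ [_ _ [_ _ [_ _ /(_ h)[_ Sr]]]]] := hopf.
by rewrite -(linZ lf) -Sr (tsum_lin _ _ lf).
Qed.

Lemma antipode1 : S 1 = 1.
Proof.
have := antipodel 1 (@lin_id _ H); rewrite comul_unit; last by slin.
by rewrite mulr1 counit1 scale1r.
Qed.

Lemma counit_antipode h : e (S h) = e h.
Proof.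
have := antipodel h lin_e; rewrite counit1.
under eq_tsum => x y do rewrite counitM mulrC.
rewrite (counitr (f := fun x => e (S x) : k^o)); last by slin.
by move=> ->; rewrite /GRing.scale /= mulr1.
Qed.


(* Both sides equal [S(x1 y1) x2 y2 S(y3) S(x3)]. *)
Lemma antipodeM x y : S (x * y) = S y * S x.
Proof.
transitivity (\sw_(x1, u <- x) \sw_(y1, v <- y) \sw_(x2, x3 <- u) \sw_(y2, y3 <- v)
    (S (x1 * y1) * (x2 * (y2 * S y3) * S x3))).
  rewrite -[LHS](counitr (f := fun x => S (x * y))); last by slin.
  apply: eq_tsum => x1 u.
  rewrite -(counitr (f := fun y => S (x1 * y))); last by slin.
  rewrite tsumZ; apply: eq_tsum => y1 v.
  under [RHS]eq_tsum => x2 x3 do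
    (rewrite (antipoder (f := fun w => S (x1 * y1) * (x2 * w * S x3))); last by slin).
  under [RHS]eq_tsum => x2 x3 do rewrite mulr1.
  rewrite -tsumZ (antipoder (f := fun w => S (x1 * y1) * w)); last by slin.
  by rewrite mulr1 !scalerA mulrC.
transitivity (\sw_(u, x3 <- x) \sw_(v, y3 <- y) \sw_(x1, x2 <- u) \sw_(y1, y2 <- v)
    (S (x1 * y1) * (x2 * (y2 * S y3) * S x3))).
  rewrite [RHS](eq_tsum _ (G := fun u x3 => \sw_(x1, x2 <- u)
     \sw_(v, y3 <- y) \sw_(y1, y2 <- v) (S (x1 * y1) * (x2 * (y2 * S y3) * S x3)))); last first.
    by move=> u x3; exact: tsum_exchange.
  rewrite coassoc; apply: eq_tsum => x1 u; rewrite tsum_exchange; apply: eq_tsum => x2 x3.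
  by rewrite coassoc.
apply: esym; rewrite -[S y](counitl _ lin_S) -[S x](counitl _ lin_S) tsumMl.
apply: eq_tsum => u x3; rewrite tsumMr; apply: eq_tsum => v y3.
rewrite -[LHS](_ : tsum (D (u * v)) (fun a b => S a * b * (S y3 * S x3)) = _); last first.
  rewrite (antipodel (f := fun w => w * (S y3 * S x3))); last by slin.
  by rewrite mul1r counitM -!scalerAl -!scalerAr scalerA mulrC.
rewrite comul_mul; last by slin.
apply: eq_tsum => x1 x2; apply: eq_tsum => y1 y2.
by rewrite !mulrA.
Qed.

(* Both sides equal [Delta(S h1) (h2 (x) h3) (S h5 (x) S h4)]. *)
Lemma comul_antipode V (F : H -> H -> V) h : bilin F ->
  tsum (D (S h)) F = \sw_(x, y <- h) F (S y) (S x).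
Proof.
move=> bF.
(* The inner pair [b2 * S v1] contracts first; its counit is then absorbed and the outer pair
   contracts in turn. *)
have key V' (G : H -> H -> V') w : bilin G ->
    \sw_(b, v <- w) \sw_(b1, b2 <- b) \sw_(v1, v2 <- v) G (b1 * S v2) (b2 * S v1)
    = e w *: G 1 1.
  move=> bG; rewrite coassoc.
  transitivity (\sw_(b1, z <- w) \sw_(z', v2 <- z) \sw_(b2, v1 <- z') G (b1 * S v2) (b2 * S v1)).
    apply: eq_tsum => b1 z; rewrite coassoc; apply: eq_tsum => b2 v.
    by [].
  transitivity (\sw_(b1, z <- w) G (b1 * S z) 1).
    apply: eq_tsum => b1 z; rewrite -[RHS](counitl (f := fun z => G (b1 * S z) 1)); last by slin.
    apply: eq_tsum => z' v2.
    by rewrite (antipoder (f := fun c => G (b1 * S v2) c)) //; slin.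
  by rewrite (antipoder (f := fun c => G c 1)) //; slin.
transitivity (\sw_(a, w <- h) \sw_(b, v <- w) \sw_(s1, s2 <- S a)
    \sw_(b1, b2 <- b) \sw_(v1, v2 <- v) F (s1 * b1 * S v2) (s2 * b2 * S v1)).
  rewrite -[LHS](counitr (f := fun h => tsum (D (S h)) F)); last by slin.
  apply: eq_tsum => a w.
  transitivity (\sw_(s1, s2 <- S a) \sw_(b, v <- w) \sw_(b1, b2 <- b) \sw_(v1, v2 <- v)
      F (s1 * (b1 * S v2)) (s2 * (b2 * S v1))).
    rewrite tsumZ; apply: eq_tsum => s1 s2.
    by rewrite (key _ (fun c d => F (s1 * c) (s2 * d))) ?mulr1 //; slin.
  rewrite tsum_exchange; apply: eq_tsum => b v; apply: eq_tsum => s1 s2.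
  by apply: eq_tsum => b1 b2; apply: eq_tsum => v1 v2; rewrite !mulrA.
rewrite -coassoc.
transitivity (\sw_(u, v <- h) (e u *: \sw_(v1, v2 <- v) F (S v2) (S v1))); last first.
  rewrite (counitl (f := fun v => \sw_(v1, v2 <- v) F (S v2) (S v1))) //; slin.
apply: eq_tsum => u v.
transitivity (\sw_(a, b <- u) \sw_(c, d <- S a * b) \sw_(v1, v2 <- v) F (c * S v2) (d * S v1)).
  by apply: eq_tsum => a b; rewrite comul_mul //; slin.
rewrite (antipodel (f := fun w => \sw_(c, d <- w) \sw_(v1, v2 <- v)
  F (c * S v2) (d * S v1))); last by slin.
congr (_ *: _); rewrite comul_unit; last by slin.
by apply: eq_tsum => v1 v2; rewrite !mul1r.
Qed.

(** * Integrals of a semisimple Hopf algebra *)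

Lemma left_integral_exists : semisimple H ->
  exists L, (forall h, h * L = e h *: L) /\ e L = 1.
Proof.
move=> ssH; have [K KE] := lin_kernel lin_e.
have idK : lideal K.
  by move=> a x; rewrite !KE counitM => /eqP ->; rewrite mulr0.
have [J [idJ KJ KJ0]] := ssH K idK.
(* Split [1] along the kernel of [e] and a complementary left ideal: the component [L] in [J] has
   counit 1, and each [h * L - e h *: L] lies in both summands. *)
have /memv_addP[x Kx [L JL xL]] : 1 \in (K + J)%VS by rewrite KJ memvf.
have eL : e L = 1.
  by rewrite -counit1 xL (linD lin_e); move: Kx; rewrite KE => /eqP ->; rewrite add0r.
exists L; split=> // h; apply/eqP; rewrite -subr_eq0 -memv0 -KJ0 memv_cap; apply/andP; split.
  rewrite KE (linB lin_e) (linZ lin_e) counitM eL.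
  by rewrite /GRing.scale /= subrr.
by rewrite memvB ?memvZ //; apply: idJ.
Qed.

(** The line spanned by [N] is a left ideal with a complement [J]. Writing [1 = c N + j] gives
    [N = c e(N) N + N j = N j], which lies in [J]. *)
Lemma left_integral_eq0 N : semisimple H ->
  (forall h, h * N = e h *: N) -> e N = 0 -> N = 0.
Proof.
move=> ssH intN eN; have [|J [idJ NJ NJ0]] := ssH <[N]>%VS.
  by move=> a x /vlineP[c ->]; rewrite -scalerAr intN !memvZ // memv_line.
have /memv_addP[x /vlineP[c ->] [j Jj E1]] : 1 \in (<[N]> + J)%VS by rewrite NJ memvf.
apply/eqP; rewrite -memv0 -NJ0 memv_cap memv_line /=.
rewrite -[N]mulr1 E1 mulrDr -scalerAr intN eN scale0r scaler0 add0r.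
exact: idJ.
Qed.

(** The defect [L * h - e h *: L] is itself a left integral, and its counit is zero. *)
Lemma integral_exists : semisimple H ->
  exists L, [/\ forall h, h * L = e h *: L, forall h, L * h = e h *: L & e L = 1].
Proof.
move=> ssH; have [L [Ll eL]] := left_integral_exists ssH.
exists L; split=> // h; apply/eqP; rewrite -subr_eq0; apply/eqP.
apply: (left_integral_eq0 ssH) => [x|].
  by rewrite mulrBr mulrA Ll -scalerAr Ll scalerBr -scalerAl !scalerA mulrC.
rewrite (linB lin_e) (linZ lin_e) counitM eL.
by rewrite /GRing.scale /= mul1r mulr1 subrr.
Qed.

(** * Coideal projections and the cointegral *)

Lemma daddv_pi0 (U W : {vspace H}) w : (U :&: W = 0)%VS -> w \in W -> daddv_pi U W w = 0.
Proof.
move=> UW0 Ww; have := daddv_pi_add UW0 (subvP (addvSr U W) _ Ww).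
by rewrite (daddv_pi_id _ Ww) 1?capvC // => /(canRL (addrK _)); rewrite subrr.
Qed.

(* The projection onto [C] along a complementary left coideal is [h |-> h1 g(h2)]. *)
Lemma coideal_projector (C : {vspace H}) : cosemisimple D -> lcoideal D C ->
  exists g : H -> k^o, [/\ lin g, forall c, c \in C -> g c = e c &
    forall h, \sw_(x, y <- h) (g y *: x) \in C].
Proof.
move=> cssH coC; have [J [coJ CJ CJ0]] := cssH C coC.
pose p := daddv_pi C J; have lp : lin p by exact: lin_linear.
(* [p] is a comodule map: it is the identity on [C] and zero on [J], and both summands are
   coideals. *)
have colin V (F : H -> H -> V) h : bilin F ->
    \sw_(x, y <- h) F x (p y) = \sw_(x, y <- p h) F x y.
  move=> bF; have bFp : bilin (fun x y => F x (p y)) by slin.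
  have hE : h = p h + daddv_pi J C h by rewrite daddv_pi_add // CJ memvf.
  have lG : lin (fun h => \sw_(x, y <- h) F x (p y)) by slin.
  rewrite {1}hE (linD lG) !tsum_rcomp //.
  rewrite [X in _ + X]big1 ?addr0 => [|i _].
    by apply: eq_bigr => i _; rewrite /p daddv_pi_id //; apply: coC; exact: memv_pi.
  rewrite /p daddv_pi0 //; last by apply: coJ; exact: memv_pi.
  by rewrite (lin0 (proj2 bF _)).
exists (fun h => e (p h)); split=> [|c Cc|h]; first by slin.
  by rewrite /p daddv_pi_id.
rewrite (colin _ (fun x y => e y *: x)); last by slin.
by rewrite (counitr _ (@lin_id _ H)) memv_pi.
Qed.

(** The line spanned by [1] is a coideal, so its projector sends [h] to a multiple of [1]; the
    counit identifies the factor as [l h]. *)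
Lemma left_cointegral_exists : cosemisimple D ->
  exists l : H -> k^o, [/\ lin l, forall h, \sw_(x, y <- h) (l y *: x) = l h *: 1 & l 1 = 1].
Proof.
move=> cssH; have [|l [ll l1 lC]] := coideal_projector (C := <[1]>%VS) cssH.
  move=> x i /vlineP[c ->].
  suff -> : rcomp (D (c *: 1)) i = (c * coord (hb H) i 1) *: 1 by rewrite memvZ ?memv_line.
  have [_ _ _ [_ _ [_ D1 _]]] := hopf.
  rewrite (linZ lin_D) -scalerA [X in _ = c *: (_ *: X)](hb_coord 1) /rcomp !scaler_sumr.
  by apply: eq_bigr => j _; rewrite mxE D1 !scalerA mulrA.
exists l; split=> // [h|]; last by rewrite l1 ?memv_line // counit1.
have /vlineP[a la] := lC h; rewrite la; congr (_ *: _).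
have := congr1 e la; rewrite (linZ lin_e) counit1.
rewrite (tsum_lin (f := e : H -> k^o)); last exact: lin_e.
under eq_tsum => x y do rewrite (linZ lin_e) /GRing.scale /= mulrC.
by rewrite (counitl (f := l)) // /GRing.scale /= mulr1 => <-.
Qed.

(** * The trace on [H (x) H] and the regular character *)

Definition tr2 (F : tens H -> tens H) : k :=
  \sum_(p < n) \sum_(q < n) F (pure (b_ p) (b_ q)) p q.

Lemma tr2_comp (F G : tens H -> tens H) : lin F ->
  tr2 (fun t => F (G t)) = \sum_(p < n) \sum_(q < n) \sum_(r < n) \sum_(s < n)
    G (pure (b_ p) (b_ q)) r s * F (pure (b_ r) (b_ s)) p q.
Proof.
move=> lF; apply: eq_bigr => p _; apply: eq_bigr => q _.
rewrite -{1}(tsumE (G _)) (tsum_lin _ _ lF) /tsum summxE; apply: eq_bigr => r _.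
by rewrite summxE; apply: eq_bigr => s _; rewrite mxE.
Qed.

Lemma tr2_comm (F G : tens H -> tens H) : lin F -> lin G ->
  tr2 (fun t => F (G t)) = tr2 (fun t => G (F t)).
Proof.
move=> lF lG; rewrite (tr2_comp _ lF) (tr2_comp _ lG).
have pairE (f : 'I_n -> 'I_n -> 'I_n -> 'I_n -> k) :
    \sum_(p < n) \sum_(q < n) \sum_(r < n) \sum_(s < n) f p q r s
    = \sum_(u : 'I_n * 'I_n) \sum_(v : 'I_n * 'I_n) f u.1 u.2 v.1 v.2.
  by rewrite pair_big; apply: eq_bigr => u _; rewrite pair_big.
rewrite !pairE exchange_big; apply: eq_bigr => u _; apply: eq_bigr => v _.
exact: mulrC.
Qed.

Definition regchar h : k := htr (fun x => h * x).

Lemma lin_regchar : lin (regchar : H -> k^o).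
Proof.
move=> a x y; rewrite /regchar /htr scaler_sumr -big_split; apply: eq_bigr => i _.
by rewrite mulrDl linearD -scalerAl linearZ.
Qed.


(* [x (x) y |-> x1 (x) x2 y] conjugates left multiplication by [h (x) 1] on
   [H (x) H] into left multiplication by [Delta(h)]. *)
Lemma regchar_conv h :
  \sw_(x, y <- h) (regchar x *: (regchar y : k^o)) = n%:R * regchar h.
Proof.
pose th t := tsum t (fun a b => \sw_(x, y <- a) pure x (y * b)).
pose th' t := tsum t (fun a b => \sw_(x, y <- a) pure x (S y * b)).
pose M t := tsum t (fun a b => pure (h * a) b).
pose N t := tsum t (fun a b => \sw_(x, y <- h) pure (x * a) (y * b)).
have bp := @bilin_pure k H.
have lth : lin th := lin_tsuml _.
have lth' : lin th' := lin_tsuml _.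
have lM : lin M := lin_tsuml _.
have lN : lin N := lin_tsuml _.
have thK t : th' (th t) = t.
  rewrite /th (tsum_lin _ _ lth') -[RHS]tsumE; apply: eq_tsum => a b.
  rewrite (tsum_lin _ _ lth').
  transitivity (\sw_(x, y <- a) \sw_(x1, x2 <- x) pure x1 (S x2 * (y * b))).
    by apply: eq_tsum => x y; rewrite /th' tsum_pure //; slin.
  rewrite coassoc -[RHS](counitr (f := fun a => pure a b)); last by slin.
  apply: eq_tsum => x y; under eq_tsum => x2 y' do rewrite mulrA.
  by rewrite (antipodel (f := fun w => pure x (w * b))) ?mul1r //; slin.
have thK' t : th (th' t) = t.
  rewrite /th' (tsum_lin _ _ lth) -[RHS]tsumE; apply: eq_tsum => a b.
  rewrite (tsum_lin _ _ lth).
  transitivity (\sw_(x, y <- a) \sw_(x1, x2 <- x) pure x1 (x2 * (S y * b))).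
    by apply: eq_tsum => x y; rewrite /th tsum_pure //; slin.
  rewrite coassoc -[RHS](counitr (f := fun a => pure a b)); last by slin.
  apply: eq_tsum => x y; under eq_tsum => x2 y' do rewrite mulrA.
  by rewrite (antipoder (f := fun w => pure x (w * b))) ?mul1r //; slin.
have Nth t : N (th t) = th (M t).
  rewrite {1}/th (tsum_lin _ _ lN) /M (tsum_lin _ _ lth); apply: eq_tsum => a b.
  rewrite (tsum_lin _ _ lN) /th tsum_pure; last by slin.
  rewrite comul_mul; last by slin.
  rewrite tsum_exchange; apply: eq_tsum => x y; rewrite /N tsum_pure; last by slin.
  by apply: eq_tsum => x' y'; rewrite mulrA.
have trN : tr2 N = \sw_(x, y <- h) (regchar x *: (regchar y : k^o)).
  rewrite /tr2.
  transitivity (\sum_(p < n) \sum_(q < n) \sw_(x, y <- h)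
      (coord (hb H) p (x * b_ p) *: (coord (hb H) q (y * b_ q) : k^o))).
    apply: eq_bigr => p _; apply: eq_bigr => q _; rewrite /N tsum_pure; last by slin.
    rewrite /tsum summxE; apply: eq_bigr => i _; rewrite summxE; apply: eq_bigr => j _.
    by rewrite !mxE.
  transitivity (\sum_(p < n) \sw_(x, y <- h) \sum_(q < n)
      (coord (hb H) p (x * b_ p) *: (coord (hb H) q (y * b_ q) : k^o))).
    apply: eq_bigr => p _; exact: (tsum_sum (V := k^o) (D h) (fun q x y =>
      coord (hb H) p (x * b_ p) *: (coord (hb H) q (y * b_ q) : k^o))).
  rewrite [LHS](tsum_sum (V := k^o) (D h) (fun p x y => \sum_(q < n)
      (coord (hb H) p (x * b_ p) *: (coord (hb H) q (y * b_ q) : k^o)))).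
  apply: (@eq_tsum _ _ k^o) => x y; rewrite /regchar /htr scaler_suml.
  by apply: eq_bigr => p _; rewrite scaler_sumr.
have trM : tr2 M = n%:R * regchar h.
  rewrite /tr2 /regchar /htr mulr_sumr; apply: eq_bigr => p _.
  have -> : n%:R = \sum_(q < n) (1 : k) by rewrite sumr_const card_ord.
  rewrite mulr_suml; apply: eq_bigr => q _.
  by rewrite /M tsum_pure ?mxE ?coord_hb ?eqxx ?mulr1 ?mul1r //; slin.
rewrite -trN -trM.
transitivity (tr2 (fun t => th (M (th' t)))).
  by apply: eq_bigr => p _; apply: eq_bigr => q _; rewrite -Nth thK'.
rewrite (tr2_comm (F := th) (G := fun t => M (th' t)) lth); last by apply: lin_comp.
by apply: eq_bigr => p _; apply: eq_bigr => q _; rewrite thK.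
Qed.

(** * Nondegeneracy of integrals and Frobenius systems *)

Section Integrals.
Variables (L : H) (l : H -> k^o).
Hypothesis Ll : forall h, h * L = e h *: L.
Hypothesis Lr : forall h, L * h = e h *: L.
Hypothesis eL : e L = 1.
Hypothesis ll : lin l.
Hypothesis l_left : forall h, \sw_(x, y <- h) (l y *: x) = l h *: 1.
Hypothesis l1 : l 1 = 1.
Local Notation c := (l L : k).

(** Writing [L1 h (x) L2 = L1 h1 (x) L2 h2 S(h3)] makes [Delta(L h1)] appear, which is
    [e(h1) Delta(L)]. *)
Lemma integral_mover V (F : H -> H -> V) h : bilin F ->
  \sw_(x, y <- L) F (x * h) y = \sw_(x, y <- L) F x (y * S h).
Proof.
move=> bF.
transitivity (\sw_(a, b <- h) \sw_(x, y <- L * a) F x (y * S b)).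
  transitivity (\sw_(a, w <- h) \sw_(a', b <- w) \sw_(x, y <- L) F (x * a) (y * (a' * S b))).
    rewrite -[LHS](counitr (f := fun h => \sw_(x, y <- L) F (x * h) y)); last by slin.
    apply: eq_tsum => a w.
    rewrite (antipoder (f := fun u => \sw_(x, y <- L) F (x * a) (y * u))); last by slin.
    by congr (_ *: _); apply: eq_tsum => x y; rewrite mulr1.
  rewrite -coassoc; apply: eq_tsum => u b.
  rewrite comul_mul; last by slin.
  rewrite [RHS]tsum_exchange; apply: eq_tsum => a a'; apply: eq_tsum => x y.
  by rewrite !mulrA.
under eq_tsum => a b do rewrite Lr.
transitivity (\sw_(a, b <- h) (e a *: \sw_(x, y <- L) F x (y * S b))).
  by apply: eq_tsum => a b; rewrite (linZ lin_D) (linZ (lin_tsuml _)).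
by rewrite (counitl (f := fun b => \sw_(x, y <- L) F x (y * S b))) //; slin.
Qed.

Lemma integral_movel V (F : H -> H -> V) h : bilin F ->
  \sw_(x, y <- L) F x (h * y) = \sw_(x, y <- L) F (S h * x) y.
Proof.
move=> bF.
transitivity (\sw_(a, b <- h) \sw_(x, y <- b * L) F (S a * x) y).
  transitivity (\sw_(w, b <- h) \sw_(a, a' <- w) \sw_(x, y <- L) F (S a * a' * x) (b * y)).
    rewrite -[LHS](counitl (f := fun h => \sw_(x, y <- L) F x (h * y))); last by slin.
    apply: eq_tsum => w b.
    rewrite (antipodel (f := fun u => \sw_(x, y <- L) F (u * x) (b * y))); last by slin.
    by congr (_ *: _); apply: eq_tsum => x y; rewrite mul1r.
  rewrite coassoc; apply: eq_tsum => a u.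
  rewrite comul_mul; last by slin.
  apply: eq_tsum => a' b; apply: eq_tsum => x y.
  by rewrite !mulrA.
under eq_tsum => a b do rewrite Ll.
transitivity (\sw_(a, b <- h) (e b *: \sw_(x, y <- L) F (S a * x) y)).
  by apply: eq_tsum => a b; rewrite (linZ lin_D) (linZ (lin_tsuml _)).
by rewrite (counitr (f := fun b => \sw_(x, y <- L) F (S b * x) y)) //; slin.
Qed.

(* [f(h) = f(h S(L1) L2)], and [L1 f(x L2) = S(x) (L1 f(L2)) = 0] for every fixed [x]. *)
Lemma integral_ndr (f : H -> k^o) : lin f ->
  \sw_(x, y <- L) (f y *: x) = 0 -> forall h, f h = 0.
Proof.
move=> lf f0 h.
have f0' x : \sw_(a, b <- L) (f (x * b) *: a) = 0.
  rewrite (integral_movel (F := fun a b => f b *: a)); last by slin.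
  under eq_tsum => a b do rewrite scalerAr.
  by rewrite -tsumMl f0 mulr0.
rewrite -[h]mulr1 -[1](scale1r (1 : H)) -eL.
rewrite -(antipodel L (@lin_id _ H)) tsumMl (tsum_lin _ _ lf).
transitivity (\sw_(a, b <- L) \sum_(i < n)
    (coord (hb H) i (h * S a) *: (f (b_ i * b) : k^o))).
  apply: eq_tsum => a b; rewrite mulrA {1}(hb_coord (h * S a)) mulr_suml (lin_sum lf).
  by apply: eq_bigr => i _; rewrite -scalerAl (linZ lf).
rewrite /tsum.
under eq_bigr => p _ do (under eq_bigr => q _ do rewrite scaler_sumr; rewrite exchange_big).
rewrite exchange_big big1 // => i _ /=.
change (tsum (D L) (fun a b => coord (hb H) i (h * S a) *: (f (b_ i * b) : k^o)) = 0).
transitivity (coord (hb H) i (h * S (\sw_(a, b <- L) (f (b_ i * b) *: a))) : k^o).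
  rewrite (tsum_lin (f := fun w => coord (hb H) i (h * S w) : k^o)); last by slin.
  apply: eq_tsum => a b; rewrite (linZ lin_S) -scalerAr linearZ /=.
  by rewrite /GRing.scale /= mulrC.
by rewrite f0' (lin0 lin_S) mulr0 linear0.
Qed.

(** Mirror image of [integral_ndr], starting from [f(h) = f(L1 S(L2) h)]. *)
Lemma integral_ndl (f : H -> k^o) : lin f ->
  \sw_(x, y <- L) (f x *: y) = 0 -> forall h, f h = 0.
Proof.
move=> lf f0 h.
have f0' x : \sw_(a, b <- L) (f (a * x) *: b) = 0.
  rewrite (integral_mover (F := fun a b => f a *: b)); last by slin.
  under eq_tsum => a b do rewrite scalerAl.
  by rewrite -tsumMr f0 mul0r.
rewrite -[h]mul1r -[1](scale1r (1 : H)) -eL.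
rewrite -(antipoder L (@lin_id _ H)) tsumMr (tsum_lin _ _ lf).
transitivity (\sw_(a, b <- L) \sum_(i < n)
    (coord (hb H) i (S b * h) *: (f (a * b_ i) : k^o))).
  apply: eq_tsum => a b; rewrite -mulrA {1}(hb_coord (S b * h)) mulr_sumr (lin_sum lf).
  by apply: eq_bigr => i _; rewrite -scalerAr (linZ lf).
rewrite /tsum.
under eq_bigr => p _ do (under eq_bigr => q _ do rewrite scaler_sumr; rewrite exchange_big).
rewrite exchange_big big1 // => i _ /=.
change (tsum (D L) (fun a b => coord (hb H) i (S b * h) *: (f (a * b_ i) : k^o)) = 0).
transitivity (coord (hb H) i (S (\sw_(a, b <- L) (f (a * b_ i) *: b)) * h) : k^o).
  rewrite (tsum_lin (f := fun w => coord (hb H) i (S w * h) : k^o)); last by slin.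
  apply: eq_tsum => a b; rewrite (linZ lin_S) -scalerAl linearZ /=.
  by rewrite /GRing.scale /= mulrC.
by rewrite f0' (lin0 lin_S) mul0r linear0.
Qed.

(** If [c] vanished, [L1 l(L2) = c 1] would be zero, and nondegeneracy would force [l = 0], against
    [l 1 = 1]. *)
Lemma cointegral_integral_neq0 : c != 0.
Proof.
apply/eqP => c0; have l0 : \sw_(x, y <- L) (l y *: x) = 0 by rewrite l_left c0 scale0r.
by have /eqP := integral_ndr ll l0 1; rewrite l1 oner_eq0.
Qed.

(** Moving [h] across [Delta(L)] leaves [L1 l(L2) = c 1]. This formula, [integral_pairr] and their
    mirror images [integral_pairl] and [integral_pairl_antipode] exhibit [Delta(L)] as a dual basis
    for the Frobenius form [l], up to [S] and [c]. *)
Lemma integral_pairr_antipode h : \sw_(x, y <- L) (l (y * S h) *: x) = c *: h.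
Proof.
rewrite -(integral_mover (F := fun x y => l y *: x)); last by slin.
under eq_tsum => x y do rewrite scalerAl.
by rewrite -tsumMr l_left -scalerAl mul1r.
Qed.

Lemma integral_pairr h : \sw_(x, y <- L) (l (h * y) *: x) = c *: S h.
Proof.
rewrite (integral_movel (F := fun x y => l y *: x)); last by slin.
under eq_tsum => x y do rewrite scalerAr.
by rewrite -tsumMl l_left -scalerAr mulr1.
Qed.

Lemma antipode_inj : injective S.
Proof.
move=> x y Sxy; apply: (scalerI cointegral_integral_neq0); rewrite -!integral_pairr_antipode.
by apply: eq_tsum => a b; rewrite Sxy.
Qed.

(** The functional [h |-> l(S h)] is a right cointegral. Its convolution with the left cointegral
    [l] equals each of the two factors, as both take the value 1 at [1]. *)
Lemma cointegral_antipode h : l (S h) = l h.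
Proof.
have lS_right x : \sw_(a, b <- x) (l (S a) *: b) = l (S x) *: 1.
  apply: antipode_inj.
  rewrite (tsum_lin _ _ lin_S) (linZ lin_S) antipode1 -l_left comul_antipode; last by slin.
  by apply: eq_tsum => a b; rewrite (linZ lin_S).
have lE (a : k) : l (a *: 1) = a by rewrite (linZ ll) l1 /GRing.scale /= mulr1.
transitivity (\sw_(a, b <- h) ((l (S a) : k) *: (l b : k^o))).
  rewrite -[LHS]lE -lS_right (tsum_lin _ _ ll).
  by apply: eq_tsum => a b; rewrite (linZ ll).
rewrite -[RHS]lE -antipode1 -(linZ lin_S) -l_left.
rewrite (tsum_lin _ _ lin_S) (tsum_lin _ _ ll).
apply: eq_tsum => a b; rewrite (linZ lin_S) (linZ ll).
by rewrite /GRing.scale /= mulrC.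
Qed.

Lemma cointegral_right h : \sw_(x, y <- h) (l x *: y) = l h *: 1.
Proof.
apply: antipode_inj; rewrite (tsum_lin _ _ lin_S) (linZ lin_S) antipode1.
rewrite -cointegral_antipode -l_left comul_antipode; last by slin.
by apply: eq_tsum => a b; rewrite (linZ lin_S) cointegral_antipode.
Qed.

Lemma integral_pairl h : \sw_(x, y <- L) (l (x * h) *: y) = c *: S h.
Proof.
rewrite (integral_mover (F := fun x y => l x *: y)); last by slin.
under eq_tsum => x y do rewrite scalerAl.
by rewrite -tsumMr cointegral_right -scalerAl mul1r.
Qed.

Lemma integral_pairl_antipode h : \sw_(x, y <- L) (l (S h * x) *: y) = c *: h.
Proof.
rewrite -(integral_movel (F := fun x y => l x *: y)); last by slin.
under eq_tsum => x y do rewrite scalerAr.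
by rewrite -tsumMl cointegral_right -scalerAr mulr1.
Qed.

(** Both functionals of [x] pair with [Delta(L)] to [c *: S h], and [integral_ndl] separates
    functionals. Thus [S^2] is the Nakayama automorphism of [l]. *)
Lemma cointegral_nakayama x h : l (x * h) = l (S (S h) * x).
Proof.
apply/eqP; rewrite -subr_eq0; apply/eqP.
apply: (integral_ndl (f := fun x => l (x * h) - l (S (S h) * x))); first by slin.
under eq_tsum => a b do rewrite scalerBl.
by rewrite tsumB integral_pairl integral_pairl_antipode subrr.
Qed.

Lemma cointegral_nakayama_inv x h : l (x * S (S h)) = l (h * x).
Proof.
apply/eqP; rewrite -subr_eq0; apply/eqP.
apply: (integral_ndr (f := fun x => l (x * S (S h)) - l (h * x))); first by slin.
under eq_tsum => a b do rewrite scalerBl.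
by rewrite tsumB integral_pairr_antipode integral_pairr subrr.
Qed.

(** The two legs of [Delta(L)] yield [S^2] and its inverse as the same Nakayama automorphism. *)
Lemma antipode4 h : S (S (S (S h))) = h.
Proof.
apply: antipode_inj; apply: (scalerI cointegral_integral_neq0); rewrite -!integral_pairr.
by apply: eq_tsum => x y; rewrite -cointegral_nakayama cointegral_nakayama_inv.
Qed.

(** * Trace formulas and the involutivity of the antipode *)

Lemma htr_integral (T : H -> H) : lin T ->
  c * htr T = \sw_(x, y <- L) (l (x * S (S (S (T y)))) : k^o).
Proof.
move=> lT.
(* The dual-basis expansion of [h]: [integral_pairl] at [S^3(h)], with [S^4 = id]. *)
have expand h : c *: h = \sw_(x, y <- L) (l (x * S (S (S h))) *: y).
  by rewrite integral_pairl antipode4.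
rewrite /htr mulr_sumr.
transitivity (\sum_(i < n) \sw_(x, y <- L)
    (l (x * S (S (S (b_ i)))) *: (coord (hb H) i (T y) : k^o))).
  apply: eq_bigr => i _.
  have lC : lin (fun w => coord (hb H) i (T w) : k^o) by slin.
  rewrite -[LHS](linZ lC) expand (tsum_lin _ _ lC).
  by apply: (@eq_tsum _ _ k^o) => x y; rewrite (linZ lC).
rewrite [LHS](tsum_sum (V := k^o) (D L) (fun i x y =>
  l (x * S (S (S (b_ i)))) *: (coord (hb H) i (T y) : k^o))).
apply: (@eq_tsum _ _ k^o) => x y.
have lf : lin (fun w => l (x * S (S (S w))) : k^o) by slin.
rewrite {2}(hb_coord (T y)) (lin_sum lf); apply: eq_bigr => i _.
by rewrite (linZ lf) /GRing.scale /= mulrC.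
Qed.

(** In particular the trace of [S^2] is nonzero. The trace formula reduces it to [l(L1 S(L2))]. *)
Lemma htr_S2 : c * htr (fun h => S (S h)) = 1.
Proof.
rewrite htr_integral; last by slin.
under eq_tsum => x y do rewrite antipode4.
by rewrite (antipoder L ll) l1 eL scale1r.
Qed.

(** The factor [l (x * S y)] contracts as in [htr_S2], and only the leg carrying [f] survives. *)
Lemma htr_S2_conv (f : H -> k^o) : lin f ->
  c * htr (fun h => S (S (\sw_(x, y <- h) (f y *: x)))) = f L.
Proof.
move=> lf; rewrite htr_integral; last by slin.
transitivity (\sw_(x, w <- L) \sw_(y, z <- w) ((f z : k) *: (l (x * S y) : k^o))).
  apply: (@eq_tsum _ _ k^o) => x w; rewrite antipode4 (tsum_lin _ _ lin_S) tsumMl (tsum_lin _ _ ll).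
  by apply: (@eq_tsum _ _ k^o) => y z; rewrite (linZ lin_S) -scalerAr (linZ ll).
rewrite -coassoc -[RHS](counitl (f := f)) //.
apply: (@eq_tsum _ _ k^o) => w z; rewrite -tsumZ (antipoder w ll) l1.
by rewrite /GRing.scale /= mulr1 mulrC.
Qed.

(** Left multiplication by [L] is the rank-one map [x |-> e x *: L], of trace [e L]. *)
Lemma regchar_integral : regchar L = 1.
Proof.
rewrite /regchar /htr -eL (hb_coord L) (lin_sum lin_e); apply: eq_bigr => i _.
by rewrite -hb_coord Lr linearZ (linZ lin_e) /GRing.scale /= mulrC.
Qed.

Lemma regchar_S2 h : regchar (S (S h)) = regchar h.
Proof.
rewrite /regchar.
transitivity (htr (fun x => S (S (h * S (S x))))).
  by apply: eq_htr => x; rewrite !antipodeM antipode4.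
rewrite (htr_comm (T := fun x => S (S x)) (P := fun x => h * S (S x))); [|by slin..].
by apply: eq_htr => x; rewrite antipode4.
Qed.

(* With [E] the normalised regular character, an idempotent of the dual algebra, both
   [Tr(S^2)] and [Tr(S^2) / dim H = Tr(S^2 | H E)] are integers; as [Tr(S^2)] is nonzero
   and the eigenvalues of [S^2] are signs, [Tr(S^2) = dim H]. *)
Lemma antipode_invol (char0 : [pchar k] =i pred0) h : S (S h) = h.
Proof.
have nat0 m : ((m%:R : k) == 0) = (m == 0)%N by apply: (pcharf0P k).1.
have two : (2%:R : k) != 0 by rewrite nat0.
have n_gt0 : (0 < n)%N.
  rewrite lt0n dimv_eq0; apply/eqP => H0.
  by have := memvf (1 : H); rewrite H0 memv0 oner_eq0.
have nk : (n%:R : k) != 0 by rewrite nat0 -lt0n.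
pose E h : k^o := (n%:R)^-1 *: (regchar h : k^o).
have lE : lin E by apply: lin_scaler; exact: lin_regchar.
pose T h := \sw_(x, y <- h) (E y *: x).
have lT : lin T by rewrite /T; slin.
have EE w : \sw_(x, y <- w) ((E x : k) *: E y) = E w.
  transitivity ((n%:R^-1 * n%:R^-1) *: \sw_(x, y <- w) (regchar x *: (regchar y : k^o))).
    rewrite tsumZ; apply: (@eq_tsum _ _ k^o) => x y; rewrite /E /GRing.scale /=.
    by rewrite mulrACA.
  by rewrite regchar_conv /E /GRing.scale /= mulrA mulfVK.
have TT x : T (T x) = T x.
  rewrite {2}/T (tsum_lin _ _ lT).
  transitivity (\sw_(u, y <- x) \sw_(a, b <- u) ((E y * E b) *: a)).
    apply: eq_tsum => u y; rewrite (linZ lT) tsumZ.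
    by apply: eq_tsum => a b; rewrite scalerA.
  rewrite coassoc; apply: eq_tsum => a w; rewrite -[in RHS]EE.
  rewrite (tsum_lin (f := fun r : k^o => r *: a)); last exact: lin_scalel.
  by apply: eq_tsum => b y; rewrite /GRing.scale /= mulrC.
have TS x : T (S (S x)) = S (S (T x)).
  rewrite /T comul_antipode; last by slin.
  rewrite comul_antipode; last by slin.
  rewrite (tsum_lin (f := fun x => S (S x))); last by slin.
  by apply: eq_tsum => a b; rewrite !(linZ lin_S) /E regchar_S2.
have lSS : lin (fun x => S (S x)) by slin.
have cN0 := cointegral_integral_neq0.
(* [r] and [s] count the eigenvalues 1 and -1 of [S^2] on [H]; below, [a] and [b] count them on the
   image of [T]. *)
have [r [s [tr1 trS r0 s0]]] :=
  htr_involution two lSS (@lin_id _ H) antipode4 (fun=> erefl) (fun=> erefl).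
have [a [b [_ trST _ _]]] := htr_involution two lSS lT antipode4 TT TS.
(* Multiplied by [c], the trace on the image of [T] is [E L], the inverse of [n], while the full
   trace is 1. *)
have trE : htr (fun x => S (S (T x))) * n%:R = htr (fun x => S (S x)).
  apply: (mulfI cN0); rewrite htr_S2 mulrA htr_S2_conv // /E regchar_integral.
  by rewrite /GRing.scale /= mulr1 mulVf.
have natI (p q : nat) : (p%:R : k) = q%:R -> p = q.
  wlog le_pq : p q / (p <= q)%N.
    by move=> W; case/orP: (leq_total p q) => ?; [exact: W | move/esym/W->].
  move/eqP; rewrite eq_sym -subr_eq0 -natrB // nat0 subn_eq0 => le_qp.
  by apply/eqP; rewrite eqn_leq le_pq.
have rs : (r + s = n)%N by apply: natI; rewrite natrD -tr1 htr_id.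
(* This is [r - s = (a - b) n] without subtraction in [nat]; as [r + s = n], the difference [a - b]
   is -1, 0 or 1. *)
have rsab : (r + b * n = s + a * n)%N.
  apply: natI; rewrite !natrD !natrM; move: trE; rewrite trST trS mulrBl => trE.
  by rewrite -[X in X + _](subrK s%:R) -trE addrAC subrK addrC.
have neq_rs : r != s.
  apply/eqP => Ers; have := htr_S2; rewrite trS Ers subrr mulr0 => /esym/eqP.
  by rewrite oner_eq0.
(* [a = b] contradicts the nonzero trace; [a < b] forces [r = 0], although [S^2] fixes [1]; the
   remaining case gives [s = 0]. *)
have [ab|ba|ab] := ltngtP a b; last by move: neq_rs rsab; rewrite ab => /eqP nrs /addIn.
- suff /r0 /(_ 1) : r = 0%N.
    rewrite !antipode1 => /eqP; rewrite -subr_eq0 opprK -mulr2n -scaler_nat scaler_eq0.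
    by rewrite (negPf two) oner_eq0.
  have : (a.+1 * n <= b * n)%N by rewrite leq_mul2r ab orbT.
  by rewrite mulSn; lia.
- suff /s0 -> : s = 0%N by [].
  have : (b.+1 * n <= a * n)%N by rewrite leq_mul2r ba orbT.
  by rewrite mulSn; lia.
Qed.

(** * Consequences of [S^2 = id] *)

Section Involutive.
Hypothesis SS : forall h, S (S h) = h.

Lemma cointegral_sym x y : l (x * y) = l (y * x).
Proof. by rewrite cointegral_nakayama SS. Qed.

(** When [S^2 = id], the two legs of [Delta(L)] obey the same dual-basis formula, which is [swap].
    Expanding the first argument of [F] along a second copy of [Delta(L)] reduces the symmetry to
    it. *)
Lemma integral_cocomm V (F : H -> H -> V) : bilin F ->
  \sw_(x, y <- L) F x y = \sw_(x, y <- L) F y x.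
Proof.
move=> bF; apply: (scalerI cointegral_integral_neq0).
have swap h : \sw_(x, y <- L) (l (x * h) *: y) = \sw_(x, y <- L) (l (y * h) *: x).
  by rewrite integral_pairl -integral_pairr_antipode SS.
have expand x y : c *: F x y = \sw_(a, b <- L) (l (x * a) *: F (S b) y).
  have lF : lin (fun w => F (S w) y) by slin.
  rewrite -{1}[x]SS -(linZ lF) -integral_pairl (tsum_lin _ _ lF).
  by apply: eq_tsum => a b; rewrite (linZ lF) cointegral_sym.
rewrite !tsumZ.
under eq_tsum => x y do rewrite expand.
under [RHS]eq_tsum => x y do rewrite expand.
rewrite tsum_exchange [RHS]tsum_exchange; apply: eq_tsum => a b.
have lF : lin (F (S b)) by slin.
transitivity (F (S b) (\sw_(x, y <- L) (l (x * a) *: y))).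
  by rewrite (tsum_lin _ _ lF); apply: eq_tsum => x y; rewrite (linZ lF).
by rewrite swap (tsum_lin _ _ lF); apply: eq_tsum => x y; rewrite (linZ lF).
Qed.

Lemma ad_S_stable (C : {vspace H}) h y : ad_invariant D S C -> y \in C ->
  \sw_(a, b <- h) (S b * y * a) \in C.
Proof.
move=> adC Cy; have := adC (S h) y Cy; rewrite comul_antipode; last by slin.
by under eq_tsum => a b do rewrite SS.
Qed.

(** From left to right: [z h = h1 S(h2) z h3], whose last three factors contract to [z]. *)
Lemma ad_central z : (forall h, \sw_(x, y <- h) (S x * z * y) = e h *: z) <-> central z.
Proof.
split=> [zc h|zc h]; last first.
  under eq_tsum => x y do rewrite -mulrA zc mulrA.
  by rewrite (antipodel (f := fun w => w * z)) ?mul1r //; slin.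
transitivity (\sw_(x, w <- h) \sw_(y, y' <- w) (x * S y * z * y')).
  rewrite -coassoc -[LHS](counitl (f := fun h => z * h)); last by slin.
  apply: eq_tsum => w y.
  by rewrite (antipoder (f := fun u => u * z * y)) ?mul1r //; slin.
rewrite -[RHS](counitr (f := fun h => h * z)); last by slin.
apply: eq_tsum => x w; rewrite scalerAr -zc tsumMl.
by apply: eq_tsum => y y'; rewrite !mulrA.
Qed.

(** * The projector onto a subcoalgebra *)

Lemma subcoalgebra_lcoideal C : subcoalgebra D C -> lcoideal D C.
Proof. by move=> subC x i /(subC x i)[]. Qed.

Lemma projector_id (C : {vspace H}) (g : H -> k^o) x : subcoalgebra D C -> lin g ->
  (forall x, x \in C -> g x = e x) -> x \in C -> \sw_(a, b <- x) (g b *: a) = x.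
Proof.
move=> subC lg gC Cx; rewrite -[RHS](counitr _ (@lin_id _ H)) !tsum_rcomp; try by slin.
by apply: eq_bigr => i _; rewrite gC //; case: (subC x i Cx).
Qed.

Lemma projector_idr (C : {vspace H}) (g : H -> k^o) x : subcoalgebra D C -> lin g ->
  (forall x, x \in C -> g x = e x) -> x \in C -> \sw_(a, b <- x) (g a *: b) = x.
Proof.
move=> subC lg gC Cx; rewrite -[RHS](counitl _ (@lin_id _ H)) !tsum_lcomp; try by slin.
by apply: eq_bigr => i _; rewrite gC //; case: (subC x i Cx).
Qed.

(* Cosemisimplicity gives [g] with [h1 g(h2)] in [C]; applied to [S(C)], it gives [g']
   with [g'(S h1) h2] in [C]; both equal the convolution of [g' S] and [g]. *)
Lemma subcoalgebra_projector (C : {vspace H}) : cosemisimple D -> subcoalgebra D C ->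
  exists g : H -> k^o, [/\ lin g, forall x, x \in C -> g x = e x,
    forall h, \sw_(x, y <- h) (g y *: x) \in C &
    forall h, \sw_(x, y <- h) (g x *: y) = \sw_(x, y <- h) (g y *: x)].
Proof.
move=> cssH subC.
have [g [lg gC gP]] := coideal_projector cssH (subcoalgebra_lcoideal subC).
pose f : {linear H -> H} := HB.pack S (GRing.isLinear.Build k H H *:%R S lin_S).
pose C' := (linfun f @: C)%VS.
have memC' x : (x \in C') = (S x \in C).
  apply/idP/idP => [/memv_imgP[y Cy ->]|Cx]; first by rewrite lfunE /= SS.
  by apply/memv_imgP; exists (S x) => //; rewrite lfunE /= SS.
have coC' : lcoideal D C'.
  move=> x i; rewrite !memC' => CSx.
  have rcompE t : rcomp t i = tsum t (fun a b => coord (hb H) i a *: b).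
    rewrite tsum_rcomp; last by slin.
    rewrite (bigD1 i) //= coord_hb eqxx scale1r big1 ?addr0 // => j ji.
    by rewrite coord_hb eq_sym (negPf ji) scale0r.
  rewrite -{1}[x]SS rcompE comul_antipode; last by slin.
  rewrite (tsum_lin _ _ lin_S).
  under eq_tsum => a b do rewrite (linZ lin_S) SS.
  rewrite tsum_lcomp; last by slin.
  by apply: memv_suml => j _; rewrite memvZ //; case: (subC _ j CSx).
have [g' [lg' g'C g'P]] := coideal_projector cssH coC'.
have g'P' h : \sw_(x, y <- h) (g' (S x) *: y) \in C.
  have := g'P (S h); rewrite memC' comul_antipode; last by slin.
  rewrite (tsum_lin _ _ lin_S).
  by under eq_tsum => a b do rewrite (linZ lin_S) SS.
have gg' h : g h = g' (S h).
  transitivity (\sw_(x, y <- h) ((g' (S x) : k) *: (g y : k^o))).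
    have lgS : lin (fun h => g' (S h)) by slin.
    transitivity (g' (S (\sw_(x, y <- h) (g y *: x)))).
      rewrite g'C; last by rewrite memC' SS.
      rewrite counit_antipode (tsum_lin (f := e : H -> k^o)); last exact: lin_e.
      rewrite -[LHS](counitl (f := g)) //.
      by apply: (@eq_tsum _ _ k^o) => x y; rewrite (linZ lin_e) /GRing.scale /= mulrC.
    rewrite (tsum_lin _ _ lgS); apply: (@eq_tsum _ _ k^o) => x y.
    by rewrite (linZ lgS) /GRing.scale /= mulrC.
  transitivity (g (\sw_(x, y <- h) (g' (S x) *: y))).
    rewrite (tsum_lin _ _ lg); apply: (@eq_tsum _ _ k^o) => x y.
    by rewrite (linZ lg).
  rewrite gC // (tsum_lin (f := e : H -> k^o)); last exact: lin_e.
  rewrite -[RHS](counitr (f := fun h => g' (S h))); last by slin.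
  by apply: (@eq_tsum _ _ k^o) => x y; rewrite (linZ lin_e) /GRing.scale /= mulrC.
exists g; split=> // h.
have gPr : \sw_(x, y <- h) (g x *: y) \in C.
  by under eq_tsum => x y do rewrite gg'.
(* Each side lies in [C], so the opposite one-sided projection fixes it; both then become
   [g(h1) g(h3) h2]. *)
rewrite -[LHS](projector_id subC lg gC gPr) -[RHS](projector_idr subC lg gC (gP h)).
pose p w := \sw_(x, y <- w) (g y *: x); pose q w := \sw_(x, y <- w) (g x *: y).
have lp : lin p by rewrite /p; slin.
have lq : lin q by rewrite /q; slin.
rewrite -/(p _) -/(q (tsum _ _)) (tsum_lin _ _ lp) (tsum_lin _ _ lq).
transitivity (\sw_(x, w <- h) \sw_(y, z <- w) (g x *: (g z *: y))).
  by apply: eq_tsum => x w; rewrite (linZ lp) tsumZ.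
rewrite -coassoc; apply: eq_tsum => w z; rewrite (linZ lq) tsumZ.
by apply: eq_tsum => x y; rewrite !scalerA mulrC.
Qed.

(** * The character of a subcoalgebra as a trace *)

Lemma comod_char_htr (C : {vspace H}) (p : H -> H) (f : H -> k^o) : lin f -> lin p ->
    subcoalgebra D C -> (forall x, x \in C -> p x = x) -> (forall x, p x \in C) ->
  f (comod_char D C) = htr (fun h => \sw_(x, y <- h) (f x *: p y)).
Proof.
move=> lf lp subC pid pC; set W := fun h => _.
have lW : lin W by rewrite /W; slin.
have WC h : W h \in C.
  by rewrite /W /tsum; apply: memv_suml => i _; apply: memv_suml => j _; rewrite !memvZ.
(* The trace of [W] can be taken on [C], which contains its image; there [p] acts trivially on the
   second leg and [comod_char] appears. *)
transitivity (\sum_(i < \dim C) coord (vbasis C) i (W (tnth (vbasis C) i)) : k).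
  rewrite /comod_char (lin_sum lf); apply: eq_bigr => j _.
  have Cj : tnth (vbasis C) j \in C by exact/vbasis_mem/mem_tnth.
  rewrite (lin_sum lf) /W tsum_rcomp; last by slin.
  rewrite linear_sum; apply: eq_bigr => i _.
  rewrite (linZ lf) linearZ pid; last by case: (subC _ i Cj).
  by rewrite /GRing.scale /= mulrC.
rewrite /htr.
transitivity (\sum_(i < n) \sum_(j < \dim C)
    coord (vbasis C) j (W (b_ i)) * coord (hb H) i (tnth (vbasis C) j)); last first.
  apply: eq_bigr => i _; rewrite [in RHS](coord_vbasis (WC (b_ i))) linear_sum.
  by apply: eq_bigr => j _; rewrite linearZ [tnth (vbasis C) j](tnth_nth 0).
rewrite [RHS]exchange_big; apply: eq_bigr => j _.
rewrite {1}(hb_coord (tnth (vbasis C) j)) (lin_sum lW) linear_sum.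
by apply: eq_bigr => i _; rewrite (linZ lW) linearZ /= mulrC.
Qed.

Lemma comod_char_integral (C : {vspace H}) (g : H -> k^o) : subcoalgebra D C -> lin g ->
    (forall x, x \in C -> g x = e x) -> (forall h, \sw_(x, y <- h) (g y *: x) \in C) ->
    (forall h, \sw_(x, y <- h) (g x *: y) = \sw_(x, y <- h) (g y *: x)) ->
  c *: comod_char D C = \sw_(x, y <- L) (g y *: x).
Proof.
move=> subC lg gC gP gcomm.
pose p h := \sw_(x, y <- h) (g x *: y).
have lp : lin p by rewrite /p; slin.
have pC x : p x \in C by rewrite /p gcomm.
have pid x : x \in C -> p x = x by move=> Cx; rewrite /p gcomm (projector_id (C := C)).
suff E (f : H -> k^o) : lin f ->
    f (c *: comod_char D C) = f (\sw_(x, y <- L) (g y *: x)).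
  rewrite (hb_coord (c *: _)) [RHS]hb_coord; apply: eq_bigr => i _; congr (_ *: _).
  exact: (E (coord (hb H) i) (lin_coord _ _)).
move=> lf; rewrite (linZ lf) (comod_char_htr (p := p)) // [LHS]htr_integral; last by slin.
transitivity (\sw_(x, w <- L) \sw_(a, b <- w) \sw_(u, v <- b)
    ((f a : k) *: ((g u : k) *: (l (x * S v) : k^o)))).
  apply: (@eq_tsum _ _ k^o) => x w; rewrite SS.
  rewrite (tsum_lin (f := fun h => l (x * S h) : k^o)); last by slin.
  apply: (@eq_tsum _ _ k^o) => a b; rewrite (linZ lin_S) -scalerAr (linZ ll) /p.
  rewrite (tsum_lin (f := fun h => l (x * S h) : k^o)); last by slin.
  rewrite tsumZ; apply: (@eq_tsum _ _ k^o) => u v.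
  by rewrite (linZ lin_S) -scalerAr (linZ ll).
(* Cocommutativity rotates the four legs of [L] cyclically, so that [v] and [x] become adjacent and
   [l (x * S v)] contracts. *)
rewrite (integral_cocomm (F := fun x w => \sw_(a, b <- w) \sw_(u, v <- b)
    ((f a : k) *: ((g u : k) *: (l (x * S v) : k^o))))); last by slin.
rewrite coassoc (tsum_lin _ _ lf); apply: (@eq_tsum _ _ k^o) => a w.
rewrite coassoc -[in RHS](counitr (f := g)) //.
rewrite (linZ lf) (tsum_lin (f := fun r : k^o => r *: (f a : k^o))); last exact: lin_scalel.
apply: (@eq_tsum _ _ k^o) => u w'; rewrite -!tsumZ.
have -> : \sw_(v, x <- w') (l (x * S v) : k^o) = e w' *: (1 : k^o).
  rewrite -l1 -(antipoder w' ll); apply: (@eq_tsum _ _ k^o) => v x.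
  by rewrite -cointegral_antipode antipodeM SS.
by rewrite /GRing.scale /= mulr1 mulrC [_ * g u]mulrC.
Qed.

(** * The adjoint action *)

Local Notation ad h x := (\sw_(a, b <- h) (a * x * S b)).

Lemma counit_ad h x : e (ad h x) = e h * e x.
Proof.
rewrite (tsum_lin (f := e : H -> k^o)); last exact: lin_e.
rewrite -[RHS](counitr (f := fun h => e h * e x : k^o)); last first.
  by move=> r u v; rewrite lin_e mulrDl scalerAl.
by apply: (@eq_tsum _ _ k^o) => a b; rewrite !counitM counit_antipode mulrC.
Qed.

Lemma ad_mul h h' x : ad (h * h') x = ad h (ad h' x).
Proof.
rewrite comul_mul; last by slin.
apply: eq_tsum => a b; rewrite tsumMl tsumMr; apply: eq_tsum => c' d'.
by rewrite antipodeM !mulrA.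
Qed.

(** As [S] reverses coproducts, the four legs of [h] are nested as [h1 x1 S(h4) (x) h2 x2 S(h3)],
    and the inner pair is an adjoint action on [x2]. *)
Lemma comul_ad V (F : H -> H -> V) h x : bilin F ->
  tsum (D (ad h x)) F =
  \sw_(a, w <- h) \sw_(u, d <- w) \sw_(x1, x2 <- x) F (a * x1 * S d) (ad u x2).
Proof.
move=> bF.
rewrite (tsum_lin (f := fun h => tsum (D h) F)); last by slin.
transitivity (\sw_(a, b <- h) \sw_(a1, a2 <- a) \sw_(x1, x2 <- x) \sw_(b1, b2 <- b)
    F (a1 * x1 * S b2) (a2 * x2 * S b1)).
  apply: eq_tsum => a b; rewrite comul_mul; last by slin.
  rewrite comul_mul; last by slin.
  apply: eq_tsum => a1 a2; apply: eq_tsum => x1 x2.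
  by rewrite comul_antipode //; slin.
rewrite coassoc; apply: eq_tsum => a w.
transitivity (\sw_(x1, x2 <- x) \sw_(a2, b <- w) \sw_(b1, b2 <- b)
    F (a * x1 * S b2) (a2 * x2 * S b1)).
  exact: tsum_exchange.
rewrite [RHS]tsum_exchange; apply: eq_tsum => x1 x2.
rewrite -coassoc; apply: eq_tsum => u d.
by rewrite (tsum_lin (f := F (a * x1 * S d))) //; slin.
Qed.

(** * Invariance of the projector against centrality and stability *)

Section Projector.
Variables (C : {vspace H}) (g : H -> k^o).
Hypothesis subC : subcoalgebra D C.
Hypothesis lg : lin g.
Hypothesis gC : forall x, x \in C -> g x = e x.
Hypothesis gP : forall h, \sw_(x, y <- h) (g y *: x) \in C.
Hypothesis gcomm : forall h, \sw_(x, y <- h) (g x *: y) = \sw_(x, y <- h) (g y *: x).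

Local Notation p h := (\sw_(x, y <- h) (g y *: x)).

Lemma central_projector : central (p L) <-> forall h x, g (ad h x) = (e h : k) *: g x.
Proof.
have lad h : lin (fun x => ad h x) by slin.
(* The factors [b] and [S a] cross to the second leg of [Delta(L)] by [integral_mover] and
   [integral_movel]. *)
have adE h : \sw_(a, b <- h) (S a * p L * b) = \sw_(x, y <- L) (g (ad h y) *: x).
  transitivity (\sw_(a, b <- h) \sw_(x, y <- L) (g (a * y * S b) *: x)).
    apply: eq_tsum => a b.
    transitivity (\sw_(x, y <- L) (g y *: (S a * (x * b)))).
      rewrite tsumMl tsumMr; apply: eq_tsum => x y.
      by rewrite -scalerAr -scalerAl mulrA.
    rewrite (integral_mover (F := fun x y => g y *: (S a * x))); last by slin.
    by rewrite -(integral_movel (F := fun x y => g (y * S b) *: x)) //; slin.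
  rewrite tsum_exchange; apply: eq_tsum => x y.
  rewrite (tsum_lin (f := fun w => g w *: x)) //.
  by apply: lin_scalel.
rewrite -ad_central; split=> [zc h x|gad h]; last first.
  by rewrite adE tsumZ; apply: eq_tsum => x y; rewrite gad scalerA.
apply/eqP; rewrite -subr_eq0; apply/eqP.
apply: (integral_ndr (f := fun x => g (ad h x) - (e h : k) *: g x)).
  by slin.
under eq_tsum => u v do rewrite scalerBl -[(e h *: g v) *: u]scalerA.
by rewrite tsumB -tsumZ -adE zc subrr.
Qed.

Lemma ad_invariant_projector :
  ad_invariant D S C <-> forall h x, g (ad h x) = (e h : k) *: g x.
Proof.
have lp : lin (fun h => p h) by slin.
have lad h : lin (fun x => ad h x) by slin.
have pad h x : p (ad h x) = \sw_(a, w <- h) \sw_(u, d <- w) \sw_(x1, x2 <- x)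
    (g (ad u x2) *: (a * x1 * S d)).
  by rewrite comul_ad //; slin.
split=> [adC|gad h x Cx]; last first.
  suff E : p (ad h x) = ad h (p x).
    by move: (gP (ad h x)); rewrite E (projector_id subC lg gC Cx).
  rewrite pad; apply: eq_tsum => a w.
  rewrite -[RHS](counitl (f := fun w => a * p x * S w)); last by slin.
  apply: eq_tsum => u d; rewrite tsumMl tsumMr tsumZ; apply: eq_tsum => x1 x2.
  by rewrite gad -scalerA -scalerAr -scalerAl.
(* The average of [g] over the adjoint action: it is invariant because [L] is a right integral, so
   it remains to show [g = g']. *)
pose g' x := g (ad L x).
have lg' : lin g' by rewrite /g'; slin.
have g'P x : \sw_(x1, x2 <- x) (g' x2 *: x1) \in C.
  (* The right side is [S(L2) p(ad(L3) x) L1], the average of the conjugates of [p], and stability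
     of [C] keeps its terms in [C]. *)
  suff -> : \sw_(x1, x2 <- x) (g' x2 *: x1) =
      \sw_(a, b <- L) \sw_(c', d <- a) (S d * p (ad b x) * c').
    rewrite {1}/tsum; apply: memv_suml => i _; apply: memv_suml => j _.
    by rewrite memvZ // ad_S_stable.
  apply: esym.
  transitivity (\sw_(c', r <- L) \sw_(d, b <- r) \sw_(a, w <- b) \sw_(u, v <- w)
      \sw_(x1, x2 <- x) (g (ad u x2) *: (S d * a * x1 * S v * c'))).
    rewrite coassoc; apply: eq_tsum => c' r; apply: eq_tsum => d b.
    rewrite pad tsumMl tsumMr; apply: eq_tsum => a w.
    rewrite tsumMl tsumMr; apply: eq_tsum => u v.
    rewrite tsumMl tsumMr; apply: eq_tsum => x1 x2.
    by rewrite -scalerAr -scalerAl !mulrA.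
  pose K c' r := \sw_(u, v <- r) \sw_(x1, x2 <- x) (g (ad u x2) *: (x1 * S v * c')).
  have bK : bilin K by rewrite /K; slin.
  transitivity (\sw_(c', r <- L) K c' r).
    apply: eq_tsum => c' r; rewrite -coassoc.
    rewrite -[RHS](counitl (f := K c')); last by slin.
    apply: eq_tsum => q w.
    rewrite (antipodel (f := fun t => \sw_(u, v <- w) \sw_(x1, x2 <- x)
        (g (ad u x2) *: (t * x1 * S v * c')))); last by slin.
    congr (_ *: _); apply: eq_tsum => u v; apply: eq_tsum => x1 x2.
    by rewrite mul1r.
  (* Cocommutativity places [c'] right after [v], so that [S v * c'] contracts. *)
  rewrite integral_cocomm // /K coassoc.
  pose M u := \sw_(x1, x2 <- x) (g (ad u x2) *: x1).
  rewrite -/(M L) -[RHS](counitr (f := M)); last by rewrite /M; slin.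
  apply: eq_tsum => u s.
  transitivity (\sw_(v, c' <- s) (M u * (S v * c'))).
    apply: eq_tsum => v c'; rewrite tsumMr; apply: eq_tsum => x1 x2.
    by rewrite -scalerAl !mulrA.
  by rewrite (antipodel (f := fun t => M u * t)) ?mulr1 //; slin.
have e_p h (f : H -> k^o) : lin f -> e (\sw_(x, y <- h) (f y *: x)) = f h.
  move=> lf; rewrite (tsum_lin (f := e : H -> k^o)); last exact: lin_e.
  rewrite -[RHS](counitl (f := f)) //.
  by apply: (@eq_tsum _ _ k^o) => x y; rewrite (linZ lin_e) /GRing.scale /= mulrC.
(* [g'] on the projection by [g] and [g] on the projection by [g'] are one convolution; since both
   projections land in [C], the first value is [g h] and the second [g' h]. *)
have gg' h : g h = g' h.
  transitivity (g' (p h)).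
    rewrite /g' [RHS]gC; last exact: adC _ _ (gP h).
    by rewrite counit_ad eL mul1r e_p.
  rewrite -gcomm -[RHS](e_p _ _ lg') -gC //.
  rewrite (tsum_lin _ _ lg') (tsum_lin _ _ lg); apply: (@eq_tsum _ _ k^o) => x y.
  by rewrite (linZ lg') (linZ lg) /GRing.scale /= mulrC.
move=> h x; rewrite gg' /g' -ad_mul Lr (linZ lin_D) (linZ (lin_tsuml _)) (linZ lg).
by rewrite [in RHS]gg'.
Qed.

End Projector.

Lemma ad_invariant_central (C : {vspace H}) : cosemisimple D -> subcoalgebra D C ->
  ad_invariant D S C <-> central (comod_char D C).
Proof.
move=> cssH subC; have [g [lg gC gP gcomm]] := subcoalgebra_projector cssH subC.
rewrite (ad_invariant_projector subC lg gC gP gcomm) -(central_projector lg).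
rewrite -(comod_char_integral subC lg gC gP gcomm); split=> zc h.
  apply: (scalerI cointegral_integral_neq0); rewrite scalerAl scalerAr.
  exact: zc.
by rewrite -scalerAl -scalerAr zc.
Qed.

End Involutive.
End Integrals.
End Hopf.

Theorem theorem2p5 (k : closedFieldType) (H : falgType k)
    (D : H -> tens H) (e : H -> k) (S : H -> H)
    (hopf : is_hopf D e S)
    (char0 : [pchar k] =i pred0)
    (ssH : semisimple H) (cssH : cosemisimple D)
    (C : {vspace H}) (subC : subcoalgebra D C) :
  ad_invariant D S C <-> central (comod_char D C).
Proof.
have [L [Ll Lr eL]] := integral_exists hopf ssH.
have [l [ll l_left l1]] := left_cointegral_exists hopf cssH.
have SS := antipode_invol hopf Ll Lr eL ll l_left l1 char0.
exact: (ad_invariant_central hopf Ll Lr eL ll l_left l1 SS).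
Qed.
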